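(* Let $\mathbb F$ be a field of characteristic $0$. Let $\{\lambda^n/\mu^n\}_{n\geq 0}$ be a graded skew partition sequence and for each $n\geq 0$ put $u_n=m_{\lambda^n/\mu^n}$. Then the set $\{u_n\}_{n\geq 0}$ is algebraically independent over $\mathbb F$ and generates $\Lambda_{\mathbb F}$ as an $\mathbb F$-algebra if and only if, for each $n\geq 1$, the partition $\lambda^n$ refines $n$.
   Context: $\Lambda_R$ denotes the ring of symmetric functions in infinitely many variables $x_1,x_2,\dots$ with coefficients in a commutative ring $R$; $m_\lambda$ is the monomial symmetric function, $h_\lambda=\prod_i h_{\lambda_i}$ the complete homogeneous symmetric functions. The Hall inner product is the bilinear form with $\langle h_\lambda,m_\mu\rangle=\delta_{\lambda\mu}$. A skew partition of $n$ is any pair $(\lambda,\mu)$ of partitions with $|\lambda|-|\mu|=n$, written $\lambda/\mu$; it is NOT assumed that $\mu\subseteq\lambda$. A graded skew partition sequence is a sequence $\{\lambda^n/\mu^n\}_{n\ge0}$ with $\lambda^n/\mu^n$ a skew partition of $n$ for each $n$. For a family $\{u_\lambda\}$ indexed by partitions, the skew version is defined by $\langle u_{\lambda/\mu},f\rangle=\langle u_\lambda,u_\mu f\rangle$ for all $f\in\Lambda_{\mathbb F}$; in particular $m_{\lambda/\mu}$ is defined by $\langle m_{\lambda/\mu},f\rangle=\langle m_\lambda,m_\mu f\rangle$. A partition $\lambda=(\lambda_1,\lambda_2,\dots)$ refines a positive integer $k$ if there exist indices $1\le i_1<i_2<\dots<i_r$ with $\lambda_{i_1}+\dots+\lambda_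{i_r}=k$.
   Formalization: The set is taken to be {u_n : n ≥ 1} instead of n ≥ 0, because u_0 is a scalar of F and a set containing a scalar is never algebraically independent. *)

(* Defs.v *)
From HB Require Import structures.
From mathcomp Require Import all_boot all_order all_algebra.
From mathcomp Require Import perm boolp classical_sets mpoly.

Set Implicit Arguments.
Unset Strict Implicit.
Unset Printing Implicit Defensive.

Import Order.TTheory GRing.Theory Num.Theory.
Local Open Scope ring_scope.

(* Partitions are the weakly decreasing lists of positive integers. The part  *)
(* lambda_i of the mathematics is nth 0 lam i.-1, which is 0 for i > size lam.  *)

Record intpart := IntPart {
  parts :> seq nat;
  partsP : sorted geq parts && (0%N \notin parts) }.

HB.instance Definition _ := [isSub for parts].
HB.instance Definition _ := [Equality of intpart by <:].

Definition weight (lam : intpart) : nat := sumn lam.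

(* Containment of mu n in lam n is deliberately not required. *)
Definition graded_skew_seq (lam mu : nat -> intpart) : Prop :=
  forall n, weight (lam n) = (weight (mu n) + n)%N.

(* The indices in I are 0-based. *)
Definition refines (lam : intpart) (k : nat) : Prop :=
  exists2 I : seq nat, sorted ltn I & (\sum_(i <- I) nth 0%N lam i)%N = k.

(* Symmetric functions in x_1, x_2, ... are the elements of bounded degree of *)
(* the inverse limit of the rings of symmetric polynomials in x_1, ..., x_n,   *)
(* under the maps setting the last variable to 0.                             *)

Definition killvar (R : comNzRingType) (n : nat) :
    {mpoly R[n.+1]} -> {mpoly R[n]} :=
  mmap (@mpolyC n R)
    (fun i : 'I_n.+1 => if unlift ord_max i is Some j then 'X_j else 0).

Record symfun (R : comNzRingType) := SymFun {
  sf :> forall n, {mpoly R[n]};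
  sf_sym : forall n, sf n \is symmetric;
  sf_compat : forall n, killvar (sf n.+1) = sf n;
  sf_bounded : exists d, forall n, (msize (sf n) <= d)%N }.

Section SymFunAlgebra.
Variable R : comNzRingType.
Implicit Types f g : symfun R.

Lemma symfunP f g : (forall n, f n = g n) -> f = g.
Proof.
case: f g => [f sf cf bf] [g sg cg bg] /= fg.
have {fg} e : f = g by apply: functional_extensionality_dep.
by subst g; congr SymFun; apply: Prop_irrelevance.
Qed.

Fact killvar_is_zmod_morphism n : zmod_morphism (@killvar R n).
Proof. by move=> p q; rewrite /killvar rmorphB. Qed.
Fact killvar_is_monoid_morphism n : monoid_morphism (@killvar R n).
Proof. by split=> [|p q]; rewrite /killvar (rmorph1, rmorphM). Qed.
HB.instance Definition _ n := GRing.isZmodMorphism.Build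
  {mpoly R[n.+1]} {mpoly R[n]} (@killvar R n) (@killvar_is_zmod_morphism n).
HB.instance Definition _ n := GRing.isMonoidMorphism.Build
  {mpoly R[n.+1]} {mpoly R[n]} (@killvar R n) (@killvar_is_monoid_morphism n).

Lemma killvarC n c : killvar c%:MP_[n.+1] = c%:MP_[n] :> {mpoly R[n]}.
Proof. exact: mmapC. Qed.

Lemma killvarZ n c (p : {mpoly R[n.+1]}) : killvar (c *: p) = c *: killvar p.
Proof. by rewrite -!mul_mpolyC rmorphM /= killvarC. Qed.

Lemma mcoeff_killvar n (p : {mpoly R[n.+1]}) (k : 'X_{1..n}) :
  (killvar p)@_k = p@_(mnmwiden k).
Proof.
rewrite {2}(mpolyE p) /killvar /mmap !raddf_sum /=; apply: eq_bigr => m _.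
rewrite mcoeffCM mcoeffZ mcoeffX; congr (_ * _).
rewrite /mmap1 big_ord_recr /= unlift_none.
have widenE (i : 'I_n) : widen_ord (leqnSn n) i = lift ord_max i.
  exact/val_inj/esym/lift_max.
have -> : \prod_(i < n)
    (if unlift ord_max (widen_ord (leqnSn n) i) is Some j then 'X_j else 0)
       ^+ m (widen_ord (leqnSn n) i)
  = 'X_[[multinom m (widen_ord (leqnSn n) i) | i < n]] :> {mpoly R[n]}.
  rewrite mpolyXE_id; apply: eq_bigr => i _.
  by rewrite mnmE {1}widenE liftK.
have [m0 | m_neq0] := eqVneq (m ord_max) 0%N; last first.
  rewrite expr0n (negbTE m_neq0) mulr0 mcoeff0; case: eqP => // e.
  by rewrite e mnmwiden_ordmax eqxx in m_neq0.
rewrite m0 expr0 mulr1 mcoeffX; congr (nat_of_bool _)%:R.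
apply/eqP/eqP => [<- | ->]; apply/mnmP => i; last first.
  by rewrite mnmE mnmwiden_widen.
case: (unliftP ord_max i) => [j | ] ->; last by rewrite m0 mnmwiden_ordmax.
by rewrite -widenE mnmwiden_widen mnmE.
Qed.

HB.instance Definition _ := gen_eqMixin (symfun R).
HB.instance Definition _ := gen_choiceMixin (symfun R).

Lemma symfun_sym0 n : (0 : {mpoly R[n]}) \is symmetric.
Proof. exact: rpred0. Qed.
Lemma symfun_bounded0 : exists d, forall n, (msize (0 : {mpoly R[n]}) <= d)%N.
Proof. by exists 0%N => n; rewrite msize0. Qed.
Definition sfzero : symfun R :=
  SymFun symfun_sym0 (fun n => rmorph0 (@killvar R n)) symfun_bounded0.

Lemma sfone_sym n : (1 : {mpoly R[n]}) \is symmetric.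
Proof. exact: rpred1. Qed.
Lemma sfone_bounded : exists d, forall n, (msize (1 : {mpoly R[n]}) <= d)%N.
Proof. by exists 1%N => n; rewrite msize1. Qed.
Definition sfone : symfun R :=
  SymFun sfone_sym (fun n => rmorph1 (@killvar R n)) sfone_bounded.

Lemma sfopp_sym f n : - f n \is symmetric.
Proof. by rewrite rpredN sf_sym. Qed.
Lemma sfopp_compat f n : killvar (- f n.+1) = - f n.
Proof. by rewrite rmorphN /= sf_compat. Qed.
Lemma sfopp_bounded f : exists d, forall n, (msize (- f n) <= d)%N.
Proof. by have [d fd] := sf_bounded f; exists d => n; rewrite msizeN. Qed.
Definition sfopp f : symfun R :=
  SymFun (sfopp_sym f) (sfopp_compat f) (sfopp_bounded f).

Lemma sfadd_sym f g n : f n + g n \is symmetric.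
Proof. by rewrite rpredD ?sf_sym. Qed.
Lemma sfadd_compat f g n : killvar (f n.+1 + g n.+1) = f n + g n.
Proof. by rewrite rmorphD /= !sf_compat. Qed.
Lemma sfadd_bounded f g : exists d, forall n, (msize (f n + g n) <= d)%N.
Proof.
have [[d fd] [e ge]] := (sf_bounded f, sf_bounded g).
exists (maxn d e) => n; apply: leq_trans (msizeD_le _ _) _.
by rewrite geq_max !leq_max fd ge orbT.
Qed.
Definition sfadd f g : symfun R :=
  SymFun (sfadd_sym f g) (sfadd_compat f g) (sfadd_bounded f g).

Lemma sfmul_sym f g n : f n * g n \is symmetric.
Proof. by rewrite rpredM ?sf_sym. Qed.
Lemma sfmul_compat f g n : killvar (f n.+1 * g n.+1) = f n * g n.
Proof. by rewrite rmorphM /= !sf_compat. Qed.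
Lemma sfmul_bounded f g : exists d, forall n, (msize (f n * g n) <= d)%N.
Proof.
have [[d fd] [e ge]] := (sf_bounded f, sf_bounded g).
exists (d + e).+1 => n; apply: leq_trans (msizeM_le _ _) _.
by rewrite ltnS leq_add.
Qed.
Definition sfmul f g : symfun R :=
  SymFun (sfmul_sym f g) (sfmul_compat f g) (sfmul_bounded f g).

Lemma sfscale_sym (c : R) f n : c *: f n \is symmetric.
Proof. by rewrite rpredZ ?sf_sym. Qed.
Lemma sfscale_compat (c : R) f n : killvar (c *: f n.+1) = c *: f n.
Proof. by rewrite killvarZ sf_compat. Qed.
Lemma sfscale_bounded (c : R) f : exists d, forall n, (msize (c *: f n) <= d)%N.
Proof.
have [d fd] := sf_bounded f.
by exists d => n; apply: leq_trans (msizeZ_le _ _) (fd n).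
Qed.
Definition sfscale (c : R) f : symfun R :=
  SymFun (sfscale_sym c f) (sfscale_compat c f) (sfscale_bounded c f).

Fact sfaddA : associative sfadd.
Proof. by move=> f g h; apply: symfunP => n; apply: addrA. Qed.
Fact sfaddC : commutative sfadd.
Proof. by move=> f g; apply: symfunP => n; apply: addrC. Qed.
Fact sfadd0 : left_id sfzero sfadd.
Proof. by move=> f; apply: symfunP => n; apply: add0r. Qed.
Fact sfaddN : left_inverse sfzero sfopp sfadd.
Proof. by move=> f; apply: symfunP => n; apply: addNr. Qed.
HB.instance Definition _ :=
  GRing.isZmodule.Build (symfun R) sfaddA sfaddC sfadd0 sfaddN.

Fact sfmulA : associative sfmul.
Proof. by move=> f g h; apply: symfunP => n; apply: mulrA. Qed.
Fact sfmulC : commutative sfmul.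
Proof. by move=> f g; apply: symfunP => n; apply: mulrC. Qed.
Fact sfmul1 : left_id sfone sfmul.
Proof. by move=> f; apply: symfunP => n; apply: mul1r. Qed.
Fact sfmulDl : left_distributive sfmul (@GRing.add (symfun R)).
Proof. by move=> f g h; apply: symfunP => n; apply: mulrDl. Qed.
Fact sfone_neq0 : sfone != 0.
Proof.
apply/eqP => /(congr1 (fun f : symfun R => (f 0%N)@_0)) /= /eqP.
by rewrite mcoeff1 mcoeff0 eqxx oner_eq0.
Qed.
HB.instance Definition _ := GRing.Zmodule_isComNzRing.Build (symfun R)
  sfmulA sfmulC sfmul1 sfmulDl sfone_neq0.

Fact sfscaleA (a b : R) f : sfscale a (sfscale b f) = sfscale (a * b) f.
Proof. by apply: symfunP => n; apply: scalerA. Qed.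
Fact sfscale1 : left_id 1 sfscale.
Proof. by move=> f; apply: symfunP => n; apply: scale1r. Qed.
Fact sfscaleDr : right_distributive sfscale +%R.
Proof. by move=> a f g; apply: symfunP => n; apply: scalerDr. Qed.
Fact sfscaleDl f : {morph sfscale^~ f : a b / a + b}.
Proof. by move=> a b; apply: symfunP => n; apply: scalerDl. Qed.
HB.instance Definition _ := GRing.Zmodule_isLmodule.Build R (symfun R)
  sfscaleA sfscale1 sfscaleDr sfscaleDl.

Fact sfscaleAl (a : R) f g : a *: (f * g) = a *: f * g.
Proof. by apply: symfunP => n; apply: scalerAl. Qed.
HB.instance Definition _ := GRing.Lmodule_isLalgebra.Build R (symfun R) sfscaleAl.
HB.instance Definition _ := GRing.Lalgebra_isComAlgebra.Build R (symfun R).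

(* Both families are given in n variables by their monomial expansion; the     *)
(* bound on the degree in the index type only makes the sum finite.            *)

Definition mexponents n (m : 'X_{1..n}) : seq nat :=
  [seq i <- multinom_val m | i != 0%N].

Definition monosym_fin (lam : intpart) n : {mpoly R[n]} :=
  \sum_(m : 'X_{1..n < (weight lam).+1} | perm_eq (mexponents m) lam) 'X_[m].

Definition homsym_fin (k n : nat) : {mpoly R[n]} :=
  \sum_(m : 'X_{1..n < k.+1} | mdeg m == k) 'X_[m].

Lemma mcoeff_bsum n d (P : pred 'X_{1..n}) (k : 'X_{1..n}) :
  (\sum_(m : 'X_{1..n < d} | P m) 'X_[R, m])@_k = ((mdeg k < d)%N && P k)%:R.
Proof.
rewrite raddf_sum /=; under eq_bigr do rewrite mcoeffX.
case: ltnP => [kd | dk] /=.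
  rewrite (eq_bigr (fun m => if m == BMultinom kd then 1 else 0)) => [|m _].
    rewrite -big_mkcondr /=; case: (boolP (P k)) => Pk.
      rewrite (big_pred1 (BMultinom kd)) // => m /=.
      by case: eqP => [->|_]; rewrite ?andbF // andbT.
    rewrite big_pred0 // => m; case: eqP => [->|_]; rewrite ?andbF //=.
    by rewrite andbT (negbTE Pk).
  by have -> : (m == BMultinom kd) = (bmnm m == k) by []; case: (bmnm m == k).
rewrite big1 // => m _; case: eqP => // e.
by have := bmdeg m; rewrite e ltnNge dk.
Qed.

Lemma sumn_mexponents n (m : 'X_{1..n}) : sumn (mexponents m) = mdeg m.
Proof.
rewrite /mexponents /mdeg; elim: (tval (multinom_val m)) => [|x s IH].
  by rewrite big_nil.
by rewrite big_cons /= -IH; case: eqP => [->|].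
Qed.

Lemma mexponents_mperm n (m : 'X_{1..n}) (s : 'S_n) :
  perm_eq (mexponents [multinom m (s i) | i < n]) (mexponents m).
Proof. by apply: perm_filter; apply/tuple_permP; exists s. Qed.

Lemma mexponents_mnmwiden n (m : 'X_{1..n}) :
  mexponents (mnmwiden m) = mexponents m.
Proof. by rewrite /mexponents /= filter_rcons. Qed.

Lemma mcoeff_monosym_fin lam n (m : 'X_{1..n}) :
  (monosym_fin lam n)@_m = (perm_eq (mexponents m) lam)%:R.
Proof.
rewrite (mcoeff_bsum _ (fun m => perm_eq (mexponents m) lam)).
case: (boolP (perm_eq _ _)) => [pm|]; last by rewrite andbF.
by rewrite -sumn_mexponents (perm_sumn pm) ltnSn.
Qed.

Lemma mcoeff_homsym_fin k n (m : 'X_{1..n}) :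
  (homsym_fin k n)@_m = (mdeg m == k)%:R.
Proof.
rewrite (mcoeff_bsum _ (fun m => mdeg m == k)).
by case: eqP => [->|]; rewrite ?ltnSn ?andbF.
Qed.

Lemma monosym_sym lam n : monosym_fin lam n \is symmetric.
Proof.
apply/issymP => s; apply/mpolyP => m.
by rewrite mcoeff_sym !mcoeff_monosym_fin (permPl (mexponents_mperm _ _)).
Qed.

Lemma monosym_compat lam n : killvar (monosym_fin lam n.+1) = monosym_fin lam n.
Proof.
apply/mpolyP => m.
by rewrite mcoeff_killvar !mcoeff_monosym_fin mexponents_mnmwiden.
Qed.

Lemma msize_bsum n d (P : pred 'X_{1..n}) :
  (msize (\sum_(m : 'X_{1..n < d} | P m) 'X_[R, m]) <= d)%N.
Proof.
apply: leq_trans (msize_sum _ _ _) _; apply/bigmax_leqP => m _.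
by rewrite msizeX bmdeg.
Qed.

Lemma monosym_bounded lam :
  exists d, forall n, (msize (monosym_fin lam n) <= d)%N.
Proof. by exists (weight lam).+1 => n;
  apply: (msize_bsum _ (fun m => perm_eq (mexponents m) lam)). Qed.

Lemma homsym_sym k n : homsym_fin k n \is symmetric.
Proof.
apply/issymP => s; apply/mpolyP => m.
by rewrite mcoeff_sym !mcoeff_homsym_fin mdeg_mperm.
Qed.

Lemma homsym_compat k n : killvar (homsym_fin k n.+1) = homsym_fin k n.
Proof.
apply/mpolyP => m; rewrite mcoeff_killvar !mcoeff_homsym_fin.
by rewrite -!sumn_mexponents mexponents_mnmwiden.
Qed.

Lemma homsym_bounded k : exists d, forall n, (msize (homsym_fin k n) <= d)%N.
Proof. by exists k.+1 => n; apply: (msize_bsum _ (fun m => mdeg m == k)). Qed.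

Definition monosym (lam : intpart) : symfun R :=
  SymFun (monosym_sym lam) (monosym_compat lam) (monosym_bounded lam).

Definition homsym (k : nat) : symfun R :=
  SymFun (homsym_sym k) (homsym_compat k) (homsym_bounded k).

Definition homsym_part (lam : intpart) : symfun R := \prod_(k <- lam) homsym k.

End SymFunAlgebra.

(* The Hall inner product is the bilinear form characterized by is_hall; hall *)
(* picks it by classical description, with the junk value 0 if there were none. *)
(* The same device defines the skew functions u_{lam/mu}.                      *)

Definition is_hall (R : comNzRingType) (B : symfun R -> symfun R -> R) : Prop :=
  bilinear_for *%R *%R B /\
  forall lam mu : intpart, B (homsym_part R lam) (monosym R mu) = (lam == mu)%:R.

Definition hall (R : comNzRingType) : symfun R -> symfun R -> R :=
  xget (fun _ _ => 0) [set B | is_hall B]%classic.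

Definition skewfun (R : comNzRingType) (u : intpart -> symfun R)
    (lam mu : intpart) : symfun R :=
  xget 0 [set v | forall f, hall v f = hall (u lam) (u mu * f)]%classic.

Definition alg_independent (R : comNzRingType) (A : comAlgType R) (S : set A) :
    Prop :=
  forall (n : nat) (x : 'I_n -> A), injective x -> (forall i, S (x i)) ->
  forall p : {mpoly R[n]}, mmap (GRing.in_alg A) x p = 0 -> p = 0.

Definition alg_generates (R : comNzRingType) (A : comAlgType R) (S : set A) :
    Prop :=
  forall Q : {pred A}, GRing.subalg_closed Q -> (forall x, S x -> x \in Q) ->
  forall a, a \in Q.

(* Main.v *)
From HB Require Import structures.
Require Import Defs.
From mathcomp Require Import all_boot all_order all_algebra.
From mathcomp Require Import perm boolp classical_sets mpoly.

Set Implicit Arguments.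
Unset Strict Implicit.
Unset Printing Implicit Defensive.

Import GRing.Theory.
Local Open Scope ring_scope.

(* Since u_n is homogeneous of degree n, u_n = c_n h_n + (products of h_k with *)
(* k < n), where c_n = <p_n, u_n> = <m_lambda, m_mu p_n>. The h_n being free    *)
(* generators, the u_n are free generators iff all c_n are nonzero.            *)
(* The number c_n is the coefficient of h_lambda in m_mu p_n. Newton's         *)
(* identities write -p_n as a polynomial in the -h_k in which every partition  *)
(* of n has a positive coefficient, and the expansion of p_n m_s in monomial   *)
(* functions propagates this to (-1)^(length s) m_s. Hence nothing cancels in  *)
(* m_mu p_n, and c_n <> 0 iff lambda is the union of a partition of |mu| and   *)
(* a partition of n.                                                           *)

(** * Partitions and coefficients of symmetric functions *)


(** The bases m and h are dual, so pairing with [mono [:: n]] extracts the coefficient of h_n in the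
    expansion by products of the h_k, and [hall_row_mul] makes this functional a derivation over the
    constant term. The elements with no h_n term therefore form a proper subalgebra; if c_n = 0 it
    contains every u_k, and generation fails ([generates_lead]). If every c_n is nonzero, [u_lead]
    allows h_n to be solved for recursively ([lead_generates]), while the products of the u_n are
    triangular over the products of the h_n for the number of parts ([prod_u_lead]), which gives
    independence ([lead_independent]).

    It remains to decide when c_n vanishes ([hall_skewfun_row]). This rests on the sign-positive
    expansions [hsupp_psum] and [hsupp_mono], which combine in [hall_mono_mul] to describe exactly
    which pairings of m_lambda with m_mu m_kappa are nonzero. That the Hall form chosen by
    description is a genuine one follows from the symmetry [sfcoef_hprodC] ([hall_exists]), and the
    skew functions exist by [skewfun_exists]. *)

Definition nonzeros (s : seq nat) : seq nat := [seq i <- s | i != 0%N].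

Lemma nonzeros_id s : 0%N \notin s -> nonzeros s = s.
Proof.
by move=> s0; apply/all_filterP/allP => i si; apply: contraNneq s0 => <-.
Qed.

Lemma mem0_nonzeros s : 0%N \notin nonzeros s.
Proof. by rewrite mem_filter eqxx. Qed.

Lemma perm_nonzeros s t : perm_eq s t -> perm_eq (nonzeros s) (nonzeros t).
Proof. exact: perm_filter. Qed.

Lemma sumn_nonzeros s : sumn (nonzeros s) = sumn s.
Proof. by elim: s => //= x s IH; case: eqP => [->|_] /=; rewrite IH. Qed.

Lemma leq_size_sumn s : 0%N \notin s -> (size s <= sumn s)%N.
Proof.
elim: s => //= x s IH; rewrite inE negb_or => /andP[x0 /IH].
by case: x x0 => // x _ le_s; rewrite addSn ltnS (leq_trans le_s) ?leq_addl.
Qed.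

Lemma sumn_eq0_nil s : 0%N \notin s -> sumn s = 0%N -> s = [::].
Proof.
by move=> /leq_size_sumn le_s e; apply: size0nil; apply/eqP; rewrite -leqn0 -e.
Qed.

Lemma intpart_mem0 (lam : intpart) : 0%N \notin (lam : seq nat).
Proof. by case/andP: (partsP lam). Qed.

Lemma perm_intpart (lam mu : intpart) : perm_eq lam mu -> lam = mu.
Proof.
move=> e; apply: val_inj => /=.
have /andP[sl _] := partsP lam; have /andP[sm _] := partsP mu.
apply: (@sorted_eq _ geq) e => // [y x z /= yx zy|x y /andP[/= yx xy]].
  exact: leq_trans zy yx.
by apply/eqP; rewrite eqn_leq xy.
Qed.

Fact mkpart_subproof s :
  let t := sort geq (nonzeros s) in sorted geq t && (0%N \notin t).
Proof.
rewrite /= mem_sort mem0_nonzeros andbT.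
by apply: sort_sorted => x y; apply: leq_total.
Qed.

Definition mkpart s : intpart := IntPart (mkpart_subproof s).

Lemma perm_mkpart s : perm_eq (mkpart s) (nonzeros s).
Proof. by rewrite /= perm_sort. Qed.

Lemma mkpart_eq (lam : intpart) s : (lam == mkpart s) = perm_eq lam (nonzeros s).
Proof.
rewrite -(permPr (perm_mkpart s)); apply/eqP/idP => [->|/perm_intpart //].
exact: perm_refl.
Qed.

Lemma mkpart_id (lam : intpart) : mkpart lam = lam.
Proof.
by apply/esym/eqP; rewrite mkpart_eq nonzeros_id ?perm_refl // intpart_mem0.
Qed.

Lemma weight_mkpart s : weight (mkpart s) = sumn s.
Proof. by rewrite /weight (perm_sumn (perm_mkpart s)) sumn_nonzeros. Qed.

Definition mnm_of N (s : seq nat) : 'X_{1..N} := [multinom nth 0%N s i | i < N].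

Lemma mexponentsE N (m : 'X_{1..N}) :
  mexponents m = nonzeros [seq m i | i <- enum 'I_N].
Proof.
rewrite /mexponents; congr filter.
rewrite -[LHS](map_tnth_enum (multinom_val m)).
by apply: eq_map => i; rewrite -mnm_tnth.
Qed.

Lemma mexponents_mnm_of N s : (size s <= N)%N -> mexponents (mnm_of N s) = nonzeros s.
Proof.
move=> sN; rewrite mexponentsE.
rewrite (eq_map (g := fun i : 'I_N => nth 0%N s i)) => [|i]; last by rewrite mnmE.
rewrite (map_comp (nth 0%N s) val) val_enum_ord -/(mkseq _ _) -(subnKC sN) /mkseq.
rewrite iotaD map_cat -/(mkseq _ _) mkseq_nth /nonzeros filter_cat.
rewrite add0n (_ : [seq i <- map _ _ | _] = [::]) ?cats0 //.
apply/eqP; rewrite -(negbK (_ == _)) -has_filter -all_predC all_map.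
apply/allP => i; rewrite mem_iota /= => /andP[si _].
by rewrite nth_default.
Qed.

(** A finite list holding every partition of weight below [d]: the number of parts is at most the
    weight, so [d] variables are enough to realise each as an exponent vector. *)
Definition intparts d : seq intpart :=
  undup [seq mkpart (mexponents (m : 'X_{1..d})) | m : 'X_{1..d < d}].

Lemma mem_intparts d (lam : intpart) : (weight lam < d)%N -> lam \in intparts d.
Proof.
have lam0 := intpart_mem0 lam; move=> lamd.
have sd : (size lam <= d)%N by apply: leq_trans (leq_size_sumn lam0) (ltnW lamd).
have md : (mdeg (mnm_of d lam) < d)%N.
  by rewrite -sumn_mexponents mexponents_mnm_of // sumn_nonzeros.
rewrite mem_undup; apply/mapP; exists (BMultinom md); first by rewrite mem_enum.
by rewrite /= mexponents_mnm_of // nonzeros_id // mkpart_id.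
Qed.

Section Coefficients.
Variable R : comNzRingType.
Implicit Types f g : symfun R.

Lemma sf_coef_widen f N N' (m : 'X_{1..N}) : (N <= N')%N ->
  exists2 m' : 'X_{1..N'}, mexponents m' = mexponents m & (f N')@_m' = (f N)@_m.
Proof.
move=> /subnK <-; elim: (N' - N)%N => [|k [m' em' fm']]; first by exists m.
exists (mnmwiden m'); first by rewrite -em' mexponents_mnmwiden.
by rewrite -mcoeff_killvar sf_compat.
Qed.

Lemma count_predC0 (s : seq nat) :
  count_mem 0%N s = (size s - size (nonzeros s))%N.
Proof.
by rewrite size_filter -(count_predC (pred1 0%N) s) addnK.
Qed.

Lemma nonzeros_perm (s t : seq nat) :
  size s = size t -> perm_eq (nonzeros s) (nonzeros t) -> perm_eq s t.
Proof.
move=> est e; apply/allP => /= x _; apply/eqP.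
have [->|x0] := eqVneq x 0%N; first by rewrite !count_predC0 est (perm_size e).
have ex u : count_mem x u = count_mem x (nonzeros u).
  rewrite count_filter; apply: eq_count => y /=.
  by case: eqP => //= ->; rewrite x0.
by rewrite ex [RHS]ex; apply/seq.permP.
Qed.

(** Padding with zeros brings both exponent vectors to [N + N'] variables, by compatibility with
    [killvar]; there they are permutations of each other and symmetry applies. *)
Lemma sf_coef_perm f N N' (m : 'X_{1..N}) (m' : 'X_{1..N'}) :
  perm_eq (mexponents m) (mexponents m') -> (f N)@_m = (f N')@_m'.
Proof.
have [m1 <- <-] := sf_coef_widen f m (leq_addr N' N).
have [m2 <- <-] := sf_coef_widen f m' (leq_addl N N').
move: (N + N')%N m1 m2 => {m m'}{}N m m' e.
have {e} : perm_eq (multinom_val m) (multinom_val m').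
  by apply: nonzeros_perm e; rewrite !size_tuple.
case/tuple_permP => s e; rewrite -[f N in RHS](issymP _ (sf_sym f N) s) mcoeff_sym.
congr (_)@_(_); apply/mnmP => i; rewrite mnmE [LHS]mnm_tnth.
have -> : multinom_val m = [tuple tnth (multinom_val m') (s i) | i < N].
  by apply: val_inj.
by rewrite tnth_mktuple.
Qed.

(** The choice of [size s] variables is immaterial: by [sfcoefE] any number of variables in which
    the monomial lives gives the same coefficient. *)
Definition sfcoef (s : seq nat) f : R := (f (size s))@_(mnm_of (size s) s).

Lemma sfcoefE f s N (m : 'X_{1..N}) :
  perm_eq (mexponents m) (nonzeros s) -> (f N)@_m = sfcoef s f.
Proof. by move=> e; apply: sf_coef_perm; rewrite mexponents_mnm_of. Qed.

Lemma sfcoef_mexponents f N (m : 'X_{1..N}) : (f N)@_m = sfcoef (mexponents m) f.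
Proof. by apply: sfcoefE; rewrite nonzeros_id // mem0_nonzeros. Qed.

Lemma sfcoef_inj f g : (forall s, 0%N \notin s -> sfcoef s f = sfcoef s g) -> f = g.
Proof.
move=> fg; apply: symfunP => N; apply/mpolyP => m.
by rewrite !sfcoef_mexponents fg ?mem0_nonzeros.
Qed.

Fact sfcoef_is_linear s : linear_for *%R (sfcoef s).
Proof. by move=> a f g; rewrite /sfcoef /= mcoeffD mcoeffZ. Qed.
HB.instance Definition _ s := GRing.isLinear.Build R (symfun R) R *%R
  (sfcoef s) (sfcoef_is_linear s).

Lemma sfcoef_monosym s lam : sfcoef s (monosym R lam) = (perm_eq (nonzeros s) lam)%:R.
Proof. by rewrite /sfcoef mcoeff_monosym_fin mexponents_mnm_of. Qed.

Definition hprod (s : seq nat) : symfun R := \prod_(k <- s) homsym R k.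

Lemma homsym0 : homsym R 0 = 1.
Proof.
apply: symfunP => N; apply/mpolyP => m.
by rewrite mcoeff_homsym_fin mcoeff1 mdeg_eq0.
Qed.

Lemma hprod1 n : hprod [:: n] = homsym R n.
Proof. exact: big_seq1. Qed.

Lemma hprod_nonzeros s : hprod (nonzeros s) = hprod s.
Proof.
rewrite /hprod big_filter [RHS](bigID (fun i => i != 0%N)) /=.
by rewrite [X in _ * X]big1 ?mulr1 // => i; rewrite negbK => /eqP->; apply: homsym0.
Qed.

Lemma hprod_perm s t : perm_eq s t -> hprod s = hprod t.
Proof. exact: perm_big. Qed.

Lemma hprod_cat s t : hprod (s ++ t) = hprod s * hprod t.
Proof. exact: big_cat. Qed.

Lemma hprod_mkpart s : hprod (mkpart s) = hprod s.
Proof. by rewrite (hprod_perm (perm_mkpart s)) hprod_nonzeros. Qed.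

(** The uniform degree bound of [f] serves as [d]: no partition of weight [d] or more has a nonzero
    coefficient, so the sum is finite. *)
Lemma sf_expansion f :
  exists d, f = \sum_(lam <- intparts d) sfcoef lam f *: monosym R lam.
Proof.
have [d fd] := sf_bounded f; exists d; apply: sfcoef_inj => s s0.
rewrite linear_sum /=.
have pe (lam : intpart) : perm_eq s lam = (lam == mkpart s).
  by rewrite mkpart_eq (nonzeros_id s0) perm_sym.
under eq_bigr do rewrite linearZ /= sfcoef_monosym (nonzeros_id s0) pe.
have [sl | sl] := boolP (mkpart s \in intparts d).
  rewrite (bigD1_seq (mkpart s)) ?undup_uniq //= big1 => [|lam /negbTE->].
    rewrite eqxx mulr1 addr0; apply: sf_coef_perm.
    by rewrite !mexponents_mnm_of // perm_nonzeros // (pe (mkpart s)) eqxx.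
  by rewrite mulr0.
rewrite big1_seq => [|lam /= ll]; last first.
  by case: eqP => [e|]; rewrite ?mulr0 //; rewrite -e ll in sl.
apply/eqP; apply: contraNT sl => fs0; apply: mem_intparts.
have fs : mnm_of (size s) s \in msupp (f (size s)) by rewrite mcoeff_msupp.
have := leq_trans (msize_mdeg_lt fs) (fd _).
by rewrite -sumn_mexponents mexponents_mnm_of // weight_mkpart sumn_nonzeros.
Qed.

End Coefficients.

(** * Symmetry of the transition matrix from h to m *)


Section Transposition.
Variable R : comNzRingType.

Let mnm_ffun d N (f : {ffun 'I_N -> 'I_d}) : 'X_{1..N} := [multinom (f j : nat) | j < N].

(** Bounding the exponents by a common [d] turns exponent vectors into a finite type, so that a
    product of several h_k can be expanded over matrices. *)
Lemma homsym_ffunE d k N : (k < d)%N ->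
  homsym R k N = \sum_(f : {ffun 'I_N -> 'I_d} | (\sum_j f j)%N == k) 'X_[mnm_ffun f].
Proof.
move=> kd; apply/mpolyP => m; rewrite mcoeff_homsym_fin raddf_sum /=.
under eq_bigr do rewrite mcoeffX.
have [mk | mk] := eqVneq (mdeg m) k; last first.
  rewrite big1 // => f /eqP fk; case: eqP => // e; case/eqP: mk.
  by rewrite -fk -e mdegE; apply: eq_bigr => j _; rewrite mnmE.
have md j : (m j < d)%N.
  by apply: leq_ltn_trans kd; rewrite -mk mdegE (bigD1 j) //= leq_addr.
rewrite (bigD1 [ffun j => Ordinal (md j)]) /=; last first.
  by rewrite -mk mdegE; apply/eqP/eq_bigr => j _; rewrite ffunE.
rewrite big1 => [|f /andP[_ ne]].
  by rewrite addr0 (_ : mnm_ffun _ = m) ?eqxx //; apply/mnmP => j; rewrite mnmE ffunE.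
case: eqP => // e; case/eqP: ne; apply/ffunP => j; apply: val_inj.
by rewrite ffunE /= -e mnmE.
Qed.

Lemma sf_prod (I : Type) (r : seq I) (F : I -> symfun R) N :
  (\prod_(i <- r) F i) N = \prod_(i <- r) F i N.
Proof. by elim/big_rec2: _ => // i p q _ <-. Qed.

Let mx d k N := {ffun 'I_k -> {ffun 'I_N -> 'I_d}}.

(** Expanding the product chooses one monomial in each factor. Row [i] of [G] is the exponent vector
    chosen in the factor of index [i], of degree b_i, and the column sums are the exponents of the
    resulting monomial. *)
Lemma sfcoef_hprodE d (a b : seq nat) : (sumn b < d)%N ->
  sfcoef a (hprod R b) = (\sum_(G : mx d (size b) (size a)
    | [forall i, (\sum_j G i j)%N == nth 0%N b i] &&
      [forall j, (\sum_i G i j)%N == nth 0%N a j]) 1)%:R.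
Proof.
move=> bd; rewrite /sfcoef /hprod sf_prod (big_nth 0%N) big_mkord.
under eq_bigr => i _.
  rewrite (@homsym_ffunE d); first over.
  apply: leq_ltn_trans bd; rewrite sumnE (big_nth 0%N) big_mkord.
  by rewrite (bigD1 i) //= leq_addr.
rewrite bigA_distr_big_dep raddf_sum /= natr_sum big_mkcond [RHS]big_mkcond /=.
apply: eq_bigr => G _.
have -> : (G \in family (fun (i : 'I_(size b)) (f : {ffun 'I_(size a) -> 'I_d}) =>
     (\sum_j f j)%N == nth 0%N b i)) = [forall i, (\sum_j G i j)%N == nth 0%N b i] by [].
case: ifP => //= _; rewrite -(big_morph _ (@mpolyXD _ R) (@mpolyX0 _ R)) mcoeffX.
set c := (X in nat_of_bool X); suff -> : c = [forall j, (\sum_i G i j)%N == nth 0%N a j].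
  by case: ifP.
apply/eqP/forallP => [e j | e].
  apply/eqP; have := congr1 (fun m : 'X_{1.._} => m j) e; rewrite mnmE => <-.
  by rewrite mnm_sumE; apply: eq_bigr => i _; rewrite mnmE.
apply/mnmP => j; rewrite mnmE -(eqP (e j)) mnm_sumE.
by apply: eq_bigr => i _; rewrite mnmE.
Qed.

(* Both sides count the nonnegative integer matrices with row sums [b] and     *)
(* column sums [a].                                                            *)
Lemma sfcoef_hprodC (a b : seq nat) :
  sfcoef a (hprod R b) = sfcoef b (hprod R a).
Proof.
pose d := (sumn a + sumn b).+1.
rewrite (@sfcoef_hprodE d) ?ltnS ?leq_addl // (@sfcoef_hprodE d) ?ltnS ?leq_addr //.
congr _%:R; pose tr k N (G : mx d k N) : mx d N k := [ffun j => [ffun i => G i j]].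
have trK k N : cancel (@tr k N) (@tr N k).
  by move=> G; apply/ffunP => i; apply/ffunP => j; rewrite !ffunE.
rewrite (reindex (@tr _ _)) /=; last by exists (@tr _ _) => G _; apply: trK.
apply: eq_bigl => G; rewrite andbC.
by congr andb; apply: eq_forallb => i; congr (_ == _);
  apply: eq_bigr => j _; rewrite !ffunE.
Qed.

End Transposition.

(** * Power sums *)


Section PowerSums.
Variable R : comNzRingType.

Lemma mcoeffXM N (k m : 'X_{1..N}) (q : {mpoly R[N]}) :
  ('X_[k] * q)@_m = if (k <= m)%MM then q@_(m - k) else 0.
Proof.
case: ifP => km; first by rewrite -{1}(submK km) addmC mulrC mcoeffMX.
rewrite [q]mpolyE mulr_sumr raddf_sum big1 //= => m' _.
rewrite -scalerAr -mpolyXD mcoeffZ mcoeffX; case: eqP => [e|]; rewrite ?mulr0 //.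
by rewrite -e lem_addr in km.
Qed.

Lemma lepm1n N (m : 'X_{1..N}) (j : 'I_N) n : (U_(j) *+ n <= m)%MM = (n <= m j)%N.
Proof.
apply/mnm_lepP/idP => [/(_ j)|nm i]; rewrite mulmnE mnm1E ?eqxx ?mul1n //.
by case: eqP => [<-|]; rewrite ?mul1n.
Qed.

Lemma mexponents_off N (m m' : 'X_{1..N}) (j : 'I_N) : (forall i, i != j -> m i = m' i) ->
  exists2 r, perm_eq (mexponents m) (nonzeros (m j :: r)) &
             perm_eq (mexponents m') (nonzeros (m' j :: r)).
Proof.
move=> mm'; exists [seq m i | i <- rem j (enum 'I_N)].
  rewrite mexponentsE perm_nonzeros // -map_cons perm_map // perm_to_rem //.
  by rewrite mem_enum.
have -> : [seq m i | i <- rem j (enum 'I_N)] = [seq m' i | i <- rem j (enum 'I_N)].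
  apply/eq_in_map => i; rewrite rem_filter ?enum_uniq // mem_filter => /andP[ij _].
  exact: mm'.
rewrite mexponentsE perm_nonzeros // -map_cons perm_map // perm_to_rem //.
by rewrite mem_enum.
Qed.

Local Notation mono s := (monosym R (mkpart s)).

Lemma mcoeff_mono s N (m : 'X_{1..N}) : 0%N \notin s ->
  (mono s N)@_m = (perm_eq (mexponents m) s)%:R.
Proof.
by move=> s0; rewrite mcoeff_monosym_fin (permPr (perm_mkpart s)) nonzeros_id.
Qed.

Lemma count_mexponents N (m : 'X_{1..N}) w : (0 < w)%N ->
  count_mem w (mexponents m) = (\sum_j (m j == w))%N.
Proof.
move=> w0; rewrite mexponentsE count_filter count_map -sum1_count big_mkcond big_enum /=.
apply: eq_bigr => j _ /=; case: eqP => [->|] //=.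
by case: w w0.
Qed.

(** The type of a monomial of type [s] after multiplication by the n-th power of a variable of
    exponent [v]. For [v] = 0 nothing is removed and [n] becomes a new part. *)
Definition shift_part n s v : seq nat := (v + n)%N :: rem v s.

(** A monomial whose type is [shift_part n s v] arises once from each of its variables of exponent
    [v + n], whence the multiplicity. *)
Lemma power_mul_fin s N n : (0 < n)%N -> 0%N \notin s ->
  (\sum_(j < N) 'X_j ^+ n) * mono s N
  = \sum_(v <- undup (0%N :: s)) (count_mem (v + n)%N (shift_part n s v))%:R
                               *: mono (shift_part n s v) N.
Proof.
move=> n0 s0; apply/mpolyP => m.
set S := undup _; have k0 v : 0%N \notin shift_part n s v.
  rewrite inE negb_or; apply/andP; split; first by case: n n0 => // n; rewrite addnS.
  by apply: contra s0; apply: mem_rem.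
(* [K] is abstract to keep [count_mem] from unfolding on it. *)
have [K KE] : {K | shift_part n s = K} by exists (shift_part n s).
rewrite KE in k0 *.
rewrite mulr_suml !raddf_sum /=.
(* The multiplicity is written as a sum over the variables of exponent [v + n], so that both sides
   can be compared one variable at a time. *)
under [RHS]eq_bigr => v _.
  rewrite mcoeffZ mcoeff_mono // -natrM mulnC.
  rewrite (_ : muln _ _ = \sum_(j < N)
      (perm_eq (mexponents m) (K v) && (m j == v + n)%N))%N; first over.
  case: (boolP (perm_eq _ _)) => pm; last by rewrite mul0n big1.
  rewrite mul1n. rewrite -(seq.permP pm) count_mexponents //.
  by rewrite addn_gt0 n0 orbT.
rewrite -natr_sum exchange_big natr_sum /=; apply: eq_bigr => j _.
rewrite mpolyXn mcoeffXM lepm1n.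
case: ifP => nm; last first.
  rewrite big1 // => v _; case: eqP => [e|]; rewrite ?andbF //.
  by rewrite e leq_addl in nm.
rewrite mcoeff_mono //.
have [r er er'] : exists2 r, perm_eq (mexponents m) (nonzeros (m j :: r)) &
    perm_eq (mexponents (m - U_(j) *+ n)) (nonzeros ((m j - n)%N :: r)).
  have [i ij|r er er'] := @mexponents_off _ m (m - U_(j) *+ n)%MM j.
    by rewrite mnmBE mulmnE mnm1E eq_sym (negbTE ij) subn0.
  by exists r => //; move: er'; rewrite mnmBE mulmnE mnm1E eqxx mul1n.
(* Here [w] is the exponent of the variable before multiplication; only the term [v = w] can
   contribute. *)
move: (m j - n)%N (subnK nm) er er' => w <- er er'; congr _%:R.
under eq_bigr => v _ do rewrite eqn_add2r (permPl er).
have wn0 : (w + n)%N != 0%N by rewrite -lt0n addn_gt0 n0 orbT.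
rewrite (permPl er') /= wn0.
have [ws | ws] := boolP (w \in S); last first.
  rewrite big1_seq => [|v /= vs]; last first.
    by case: eqP => [e|]; rewrite ?andbF //; rewrite e vs in ws.
  move: ws; rewrite /S mem_undup inE negb_or => /andP[-> ws].
  by apply/eqP; rewrite eqb0; apply: contra ws => /perm_mem <-; rewrite mem_head.
rewrite (bigD1_seq w) ?undup_uniq //= big1 => [|v /negbTE]; last first.
  by rewrite eq_sym => ->; rewrite andbF.
rewrite eqxx andbT addn0 -KE /shift_part perm_cons; move: ws; rewrite /S mem_undup inE.
have [->|w0 /=] := eqVneq w 0%N; first by rewrite rem_id.
by move=> /perm_to_rem /permPr ->; rewrite perm_cons.
Qed.

Definition psum n : symfun R := mono [:: n].

Lemma mono_nil : mono [::] = 1.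
Proof.
apply: symfunP => N; apply/mpolyP => m; rewrite mcoeff_mono // mcoeff1.
rewrite -mdeg_eq0 -sumn_mexponents; congr (nat_of_bool _)%:R.
apply/perm_nilP/eqP => [-> //|m0].
exact: sumn_eq0_nil (mem0_nonzeros _) m0.
Qed.

Lemma psumE n N : (0 < n)%N -> psum n N = \sum_(j < N) 'X_j ^+ n.
Proof.
move=> n0; have := @power_mul_fin [::] N n n0 isT.
by rewrite mono_nil /= mulr1 big_seq1 add0n eqxx scale1r.
Qed.

Lemma sf_sum (I : Type) (r : seq I) (P : pred I) (F : I -> symfun R) N :
  (\sum_(i <- r | P i) F i) N = \sum_(i <- r | P i) F i N.
Proof. exact: (big_morph (fun f : symfun R => f N)). Qed.

Lemma psum_mul s n : (0 < n)%N -> 0%N \notin s ->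
  psum n * mono s
  = \sum_(v <- undup (0%N :: s)) (count_mem (v + n)%N (shift_part n s v))%:R
                               *: mono (shift_part n s v).
Proof.
move=> n0 s0; apply: symfunP => N; rewrite /= [monosym_fin _ _ _]psumE //.
by rewrite power_mul_fin // sf_sum.
Qed.

(** At a monomial of degree [n] the right side counts the pairs of a variable and an [i] between 1
    and its exponent; their number is the sum of the exponents, which is [n]. *)
Lemma newton n :
  homsym R n *+ n = \sum_(1 <= i < n.+1) psum i * homsym R (n - i).
Proof.
apply: symfunP => N; apply/mpolyP => m.
rewrite sf_sum -[n in LHS]card_ord -sumr_const sf_sum sumr_const card_ord mcoeffMn.
rewrite mcoeff_homsym_fin raddf_sum /=.
transitivity ((\sum_(1 <= i < n.+1) \sum_(j < N) ((i <= m j) && (mdeg m == n)))%N%:R : R).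
  rewrite exchange_big /=.
  have [mn|] := eqVneq (mdeg m) n; last first.
    by rewrite mul0rn => _; rewrite big1 // => j _; rewrite big1 // => i _; rewrite andbF.
  congr _%:R; rewrite -{1}mn mdegE; apply: eq_bigr => j _.
  have jn : (m j <= n)%N by rewrite -mn mdegE (bigD1 j) //= leq_addr.
  rewrite (big_cat_nat (n := (m j).+1)) //= [X in (_ + X)%N]big1_seq => [|i]; last first.
    by rewrite mem_index_iota andbT ltnNge => /andP[_ /andP[/negbTE->]].
  rewrite addn0 big_nat (eq_bigr (fun=> 1%N)) => [|i /andP[_]]; last first.
    by rewrite ltnS => ->.
  by rewrite -big_nat sum_nat_const_nat subn1 muln1.
rewrite natr_sum; apply: eq_big_nat => i /andP[i0 iN].
rewrite natr_sum /= [monosym_fin _ _ _]psumE // mulr_suml raddf_sum /=.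
apply: eq_bigr => j _; rewrite mpolyXn mcoeffXM lepm1n.
case: ifP => //= im; rewrite mcoeff_homsym_fin; congr _%:R; congr nat_of_bool.
have /submK mE : (U_(j) *+ i <= m)%MM by rewrite lepm1n.
by rewrite -{1}mE mdegD mdegMn mdeg1 mul1n -{1}(subnK (ltnSE iN)) eqn_add2r.
Qed.
End PowerSums.

(** * Sign-positive expansions *)


Section Positivity.
Variable F : fieldType.
Hypothesis F_char0 : [pchar F] =i pred0.
Local Notation mono s := (monosym F (mkpart s)).

Lemma natF_neq0 n : n.+1%:R != 0 :> F.
Proof. by move/pcharf0P: F_char0 => ->. Qed.

(** A substitute for positivity in a field without order: these elements are stable under sums and
    products, and nonzero in characteristic 0. *)
Definition posrat (x : F) := exists a b : nat, x = a.+1%:R / b.+1%:R.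

Lemma posratD x y : posrat x -> posrat y -> posrat (x + y).
Proof.
case=> a [b ->] [c [d ->]]; rewrite addf_div ?natF_neq0 // -!natrM -natrD.
by exists (a.+1 * d.+1 + c.+1 * b.+1).-1, (b.+1 * d.+1).-1.
Qed.

Lemma posratM x y : posrat x -> posrat y -> posrat (x * y).
Proof.
case=> a [b ->] [c [d ->]]; rewrite mulf_div -!natrM.
by exists (a.+1 * c.+1).-1, (b.+1 * d.+1).-1.
Qed.

Lemma posratV x : posrat x -> posrat x^-1.
Proof. by case=> a [b ->]; rewrite invf_div; exists b, a. Qed.

Lemma posrat_nat n : (0 < n)%N -> posrat n%:R.
Proof. by case: n => // n _; exists n, 0%N; rewrite divr1. Qed.

Lemma posrat_neq0 x : posrat x -> x != 0.
Proof. by case=> a [b ->]; rewrite mulf_neq0 ?invr_neq0 ?natF_neq0. Qed.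

Definition signed_hprod (s : seq nat) : symfun F := \prod_(k <- s) (- homsym F k).

Lemma signed_hprodE s : signed_hprod s = (-1) ^+ size s *: hprod F s.
Proof.
rewrite /signed_hprod /hprod; elim: s => [|k s IH]; first by rewrite !big_nil scale1r.
by rewrite !big_cons IH exprS mulN1r scaleNr -scalerAr mulNr scalerN.
Qed.

(* The expansion of [g] in the products of the [- h_k] has positive rational   *)
(* coefficients, and its support consists of the partitions satisfying [D].    *)
Definition hsupp (D : seq nat -> Prop) (g : symfun F) := exists l : seq (F * seq nat),
  [/\ g = \sum_(p <- l) p.1 *: signed_hprod p.2,
      forall p, p \in l -> [/\ posrat p.1, 0%N \notin p.2 & D p.2] &
      forall s, 0%N \notin s -> D s -> exists2 p, p \in l & perm_eq p.2 s].

Lemma hsupp_ext D D' g : (forall s, 0%N \notin s -> D s <-> D' s) ->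
  hsupp D g -> hsupp D' g.
Proof.
move=> e [l [-> lD Dl]]; exists l; split=> // [p /lD[? p0 /(e _ p0)] // |s s0 /(e _ s0)].
exact: Dl.
Qed.

Lemma hsupp0 : hsupp (fun=> False) 0.
Proof. by exists [::]; split=> //; rewrite big_nil. Qed.

Lemma hsuppD D D' f g : hsupp D f -> hsupp D' g ->
  hsupp (fun s => D s \/ D' s) (f + g).
Proof.
case=> l [-> lD Dl] [l' [-> lD' Dl']]; exists (l ++ l'); split.
- by rewrite big_cat.
- by move=> p; rewrite mem_cat => /orP[/lD[? ? ?]|/lD'[? ? ?]]; split=> //; [left|right].
- by move=> s s0 [/(Dl _ s0)|/(Dl' _ s0)] [p pl ps]; exists p;
    rewrite // mem_cat pl ?orbT.
Qed.

Lemma hsupp_sum (I : eqType) (r : seq I) (D : I -> seq nat -> Prop) (f : I -> symfun F) :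
  (forall i, i \in r -> hsupp (D i) (f i)) ->
  hsupp (fun s => exists2 i, i \in r & D i s) (\sum_(i <- r) f i).
Proof.
elim: r => [_|i r IH Df].
  by rewrite big_nil; apply: hsupp_ext hsupp0 => s _; split=> [|[]].
rewrite big_cons; have ri j : j \in r -> hsupp (D j) (f j).
  by move=> jr; apply: Df; rewrite inE jr orbT.
apply: hsupp_ext (hsuppD (Df i (mem_head _ _)) (IH ri)) => s _; split.
  by case=> [Ds|[j jr Ds]]; [exists i | exists j] => //; rewrite inE ?eqxx ?jr ?orbT.
by case=> j; rewrite inE => /predU1P[->|jr] Ds; [left|right; exists j].
Qed.

Lemma hsuppZ D c g : posrat c -> hsupp D g -> hsupp D (c *: g).
Proof.
move=> cp [l [-> lD Dl]]; exists [seq (c * p.1, p.2) | p <- l]; split.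
- by rewrite big_map scaler_sumr; apply: eq_bigr => p _; rewrite scalerA.
- by move=> _ /mapP[p /lD[pp p0 Dp] ->]; split=> //=; apply: posratM.
- move=> s s0 /(Dl _ s0)[p pl ps]; exists (c * p.1, p.2) => //.
  exact: map_f (fun p : F * seq nat => (c * p.1, p.2)) _ _ pl.
Qed.

Definition splits (D D' : seq nat -> Prop) s :=
  exists a b, [/\ perm_eq (a ++ b) s, 0%N \notin a, 0%N \notin b, D a & D' b].

Lemma hsuppM D D' f g : hsupp D f -> hsupp D' g -> hsupp (splits D D') (f * g).
Proof.
case=> l [-> lD Dl] [l' [-> lD' Dl']].
pose m (p q : F * seq nat) := (p.1 * q.1, p.2 ++ q.2).
exists [seq m p q | p <- l, q <- l']; split.
- rewrite big_allpairs_dep mulr_suml; apply: eq_bigr => p _; rewrite mulr_sumr.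
  apply: eq_bigr => q _; rewrite -scalerAl -scalerAr scalerA /signed_hprod big_cat.
  by [].
- move=> _ /allpairsP[[p q] [/lD[pp p0 Dp] /lD'[qp q0 Dq] ->]]; split.
  + exact: posratM.
  + by rewrite /= mem_cat negb_or p0.
  + by exists p.2, q.2; split=> //; apply: perm_refl.
- move=> s s0 [a [b [ab a0 b0 /(Dl _ a0)[p pl pa] /(Dl' _ b0)[q ql qb]]]].
  exists (m p q); first exact: allpairs_f.
  by rewrite -(permPr ab) perm_cat.
Qed.

Definition partition_of d (s : seq nat) : Prop := sumn s = d.

(** Newton's identity reads -p_n = n (-h_n) + sum of (-p_i)(-h_{n-i}) over 0 < i < n, with positive
    signs throughout. A partition of [n] with several parts splits off one part [n - i] and leaves a
    partition of [i], so every partition occurs. *)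
Lemma hsupp_psum n : (0 < n)%N -> hsupp (partition_of n) (- psum F n).
Proof.
elim/ltn_ind: n => n IH n0.
have e : - psum F n = n%:R *: signed_hprod [:: n]
    + \sum_(i <- index_iota 1 n) - psum F i * signed_hprod [:: (n - i)%N].
  have := newton F n; rewrite big_nat_recr //= subnn homsym0 mulr1 => e.
  under eq_bigr do rewrite /signed_hprod big_seq1 mulrNN.
  by rewrite /signed_hprod big_seq1 scaler_nat mulNrn e opprD addrAC addNr add0r.
have hk k : (0 < k)%N -> hsupp (fun s => s = [:: k]) (signed_hprod [:: k]).
  move=> k0; exists [:: (1, [:: k])]; split.
  - by rewrite big_seq1 scale1r.
  - move=> _ /[!inE] /eqP-> /=; split=> //; first exact: (posrat_nat (n := 1)).
    by rewrite inE eq_sym -lt0n.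
  - by move=> s _ ->; exists (1, [:: k]); rewrite ?inE.
rewrite e; have hi i : i \in index_iota 1 n -> hsupp (splits (partition_of i)
    (fun s => s = [:: (n - i)%N])) (- psum F i * signed_hprod [:: (n - i)%N]).
  rewrite mem_index_iota => /andP[i0 iN]; apply: hsuppM; first exact: IH.
  by apply: hk; rewrite subn_gt0.
apply: hsupp_ext (hsuppD (hsuppZ (posrat_nat n0) (hk _ n0)) (hsupp_sum hi)) => s s0.
split=> [[->|[i]]|sn].
- by rewrite /partition_of /= addn0.
- rewrite mem_index_iota => /andP[i0 iN] [a [b [/perm_sumn ab _ _ ai b_eq]]].
  by rewrite /partition_of -ab b_eq sumn_cat ai /= addn0 subnKC // ltnW.
- case: s s0 sn => [_ n_eq|k s]; first by rewrite -n_eq in n0.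
  rewrite inE negb_or /partition_of => /andP[k0 s0] /= sn.
  case: (posnP (sumn s)) => [s_eq|s_gt].
    by left; rewrite -sn s_eq addn0 (sumn_eq0_nil s0 s_eq).
  right; exists (sumn s).
    by rewrite mem_index_iota s_gt -sn -[X in (X < _)%N]add0n ltn_add2r lt0n eq_sym.
  exists s, [:: k]; split=> //; first by rewrite perm_catC.
    by rewrite inE.
  by rewrite -sn addnK.
Qed.

(** Induction on the number of parts. In p_n m_t the term m_{n::t} has one part more than the merged
    terms, so solving for it gives, up to sign, (-p_n) times signed m_t plus the signed merged
    terms, all with positive coefficients. *)
Lemma hsupp_mono s : 0%N \notin s ->
  hsupp (partition_of (sumn s)) ((-1) ^+ size s *: mono s).
Proof.
have [k] := ubnP (size s); elim: k s => // k IH [|n t] /=.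
  move=> _ _; exists [:: (1, [::])]; split.
  - by rewrite big_seq1 expr0 !scale1r mono_nil /signed_hprod big_nil.
  - by move=> p /[!inE] /eqP->; split=> //; apply: (posrat_nat (n := 1)).
  - move=> s s0 sn; exists (1, [::]); first by rewrite inE.
    by rewrite (sumn_eq0_nil s0 sn).
rewrite ltnS => tk; rewrite inE negb_or eq_sym -lt0n => /andP[n0 t0].
pose c v : F := (count_mem (v + n)%N (shift_part n t v))%:R.
have cp v : posrat (c v).
  apply: posrat_nat; rewrite -has_count; apply/hasP; exists (v + n)%N => //=.
  exact: mem_head.
have := psum_mul F n0 t0; rewrite /= (negbTE t0) big_cons -/(c 0%N).
rewrite (_ : shift_part n t 0 = n :: t) => [e|]; last by rewrite /shift_part rem_id.
have {}e : (-1) ^+ size (n :: t) *: mono (n :: t) = (c 0%N)^-1 *: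
   (- psum F n * ((-1) ^+ size t *: mono t)
    + \sum_(v <- undup t) 
        c v *: ((-1) ^+ size (shift_part n t v) *: mono (shift_part n t v))).
  apply: (scalerI (posrat_neq0 (cp 0%N))).
  rewrite [RHS]scalerA divff ?posrat_neq0 // scale1r.
  rewrite scalerA mulrC -scalerA (canRL (addrK _) (esym e)) /= exprS mulN1r scaleNr.
  rewrite scalerBr opprB addrC mulNr -scalerAr; congr (_ + _).
  rewrite scaler_sumr; apply: eq_big_seq => v; rewrite mem_undup => vt.
  rewrite !scalerA mulrC /= size_rem // prednK //.
  by case: (t) vt.
rewrite e; apply: hsuppZ; first exact: posratV.
have ht : hsupp (splits (partition_of n) (partition_of (sumn t)))
    (- psum F n * ((-1) ^+ size t *: mono t)).
  by apply: hsuppM; [apply: hsupp_psum | apply: IH].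
have hv v : v \in undup t -> hsupp (partition_of (n + sumn t))
   (c v *: ((-1) ^+ size (shift_part n t v) *: mono (shift_part n t v))).
  rewrite mem_undup => vt; apply: hsuppZ => //.
  have -> : (n + sumn t)%N = sumn (shift_part n t v).
    by rewrite /= (perm_sumn (perm_to_rem vt)) /= addnCA addnA.
  apply: IH.
    by rewrite /= size_rem // prednK //; case: (t) vt.
  rewrite inE negb_or eq_sym -lt0n addn_gt0 n0 orbT /=.
  by apply: contra t0; apply: mem_rem.
apply: hsupp_ext (hsuppD ht (hsupp_sum hv)) => s s0; split.
  case=> [[a [b [/perm_sumn ab _ _ an bt]]]|[]//].
  by rewrite /partition_of -ab sumn_cat an bt.
(* A single merged term already has full support. If there is none, [t] is empty and the power sum
   alone supplies every partition. *)
move=> sn; case: (t) sn => [|v t'] sn; last first.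
  by right; exists v; rewrite // mem_undup mem_head.
left; exists s, [::]; rewrite cats0; split=> //.
by rewrite /partition_of sn addn0.
Qed.

(* All the terms contributing to [L g] have the same sign, so none cancel.     *)
Lemma hsupp_functional (L : symfun F -> F) (lam : seq nat) D g :
  (forall c f h, L (c *: f + h) = c * L f + L h) ->
  (forall s, 0%N \notin s -> L (hprod F s) = (perm_eq s lam)%:R) ->
  0%N \notin lam -> (forall s t, perm_eq s t -> D s -> D t) ->
  hsupp D g -> L g != 0 <-> D lam.
Proof.
move=> Llin Lh lam0 Dperm [l [-> lD Dl]].
have L0 : L 0 = 0 by have := Llin (-1) 0 0; rewrite scaleN1r addNr mulN1r addNr.
have LZ c f : L (c *: f) = c * L f by have := Llin c f 0; rewrite L0 !addr0.
have LE : L (\sum_(p <- l) p.1 *: signed_hprod p.2)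
    = (-1) ^+ size lam * \sum_(p <- l | perm_eq p.2 lam) p.1.
  rewrite (big_morph L (id1 := 0) (op1 := +%R)) => [|f h|]; last 2 first.
  - by rewrite -[f]scale1r Llin mul1r scale1r.
  - by [].
  rewrite mulr_sumr [RHS]big_mkcond /= big_seq [RHS]big_seq.
  apply: eq_bigr => p /lD[_ p0 _]; rewrite signed_hprodE !LZ Lh //.
  case: ifP => pl; rewrite /= ?mulr0 // (perm_size pl).
  by rewrite mulr1 mulrC.
rewrite LE mulf_eq0 signr_eq0 /=.
split=> [|Dlam].
  apply: contra_neqP => nD; rewrite big1_seq // => p /andP[pl /lD[_ _ Dp]].
  by case: nD; apply: Dperm Dp.
have [p pl plam] := Dl _ lam0 Dlam.
apply: posrat_neq0; rewrite -big_filter.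
have : p \in [seq i <- l | perm_eq i.2 lam] by rewrite mem_filter plam.
have : {in [seq i <- l | perm_eq i.2 lam], forall i, posrat i.1}.
  by move=> i; rewrite mem_filter => /andP[_ /lD[]].
elim: [seq i <- l | _] p {pl plam} => //= q r IH p rp _.
rewrite big_cons; case: r IH rp => [|q' r] IH rp.
  by rewrite big_nil addr0; apply: rp; apply: mem_head.
apply: posratD; first by apply: rp; apply: mem_head.
by apply: (IH q') => [i ir|]; [apply: rp; rewrite inE ir orbT | apply: mem_head].
Qed.

End Positivity.

(** * The Hall inner product and skew functions *)


(** Selected parts and remaining parts split the list; selected indices past the last part
    contribute 0 and are discarded. *)
Lemma refinesP (lam : intpart) n : refines lam n <->
  exists a b, perm_eq (a ++ b) lam /\ sumn b = n.
Proof.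
split=> [[I sI sumI] | [a [b [ab <-]]]]; last first.
  (* [Is] lists the positions in [lam] of the entries of [a ++ b]; its tail [J] gives those of
     [b]. *)
  have [Is pIs abE] := perm_iotaP 0%N ab.
  pose J := drop (size a) Is; have uJ : uniq J.
    by rewrite drop_uniq // (perm_uniq pIs) iota_uniq.
  exists (sort leq J).
    by rewrite ltn_sorted_uniq_leq sort_uniq uJ sort_sorted //; apply: leq_total.
  rewrite (perm_big J) ?perm_sort //= -(big_map (nth 0%N lam) xpredT id) -sumnE.
  by rewrite map_drop -abE drop_size_cat.
pose p i := i \in I; pose idx := iota 0 (size lam).
have lamE : lam = map (nth 0%N lam) idx :> seq nat by rewrite -/(mkseq _ _) mkseq_nth.
exists (map (nth 0%N lam) (filter (predC p) idx)), (map (nth 0%N lam) (filter p idx)).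
split.
  by rewrite -map_cat [X in perm_eq _ X]lamE perm_map // perm_catC perm_filterC.
rewrite sumnE big_map -sumI [RHS](bigID (fun i => i < size lam)%N) /=.
rewrite [X in (_ + X)%N]big1 => [|i]; last by rewrite -leqNgt => /(nth_default 0%N).
rewrite addn0 -[RHS]big_filter; apply/perm_big/uniq_perm.
- by rewrite filter_uniq // iota_uniq.
- by rewrite filter_uniq //; move: sI; rewrite ltn_sorted_uniq_leq => /andP[].
by move=> i; rewrite !mem_filter mem_iota /= add0n andbC.
Qed.

Section Hall.
Variable F : fieldType.
Hypothesis F_char0 : [pchar F] =i pred0.
Local Notation mono s := (monosym F (mkpart s)).

Lemma sf_mono_ind (P : symfun F -> Prop) : P 0 ->
  (forall c f g, P f -> P g -> P (c *: f + g)) -> (forall lam, P (monosym F lam)) ->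
  forall f, P f.
Proof.
move=> P0 PD Pm f; have [d ->] := sf_expansion f.
elim/big_ind: _ => // [g h Pg Ph|lam _].
  by rewrite -[g]scale1r; apply: PD.
by rewrite -[_ *: _]addr0; apply: PD.
Qed.

Definition hspan (D : seq nat -> Prop) (f : symfun F) :=
  exists2 l : seq (F * seq nat), f = \sum_(p <- l) p.1 *: hprod F p.2 &
    forall p, p \in l -> 0%N \notin p.2 /\ D p.2.

Lemma hspan_hprod D s : 0%N \notin s -> D s -> hspan D (hprod F s).
Proof.
move=> s0 Ds; exists [:: (1, s)]; first by rewrite big_seq1 scale1r.
by move=> _ /[!inE] /eqP->.
Qed.

Lemma hspan0 D : hspan D 0.
Proof. by exists [::]; rewrite ?big_nil. Qed.

Lemma hspanP D c f g : hspan D f -> hspan D g -> hspan D (c *: f + g).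
Proof.
move=> [l -> lD] [l' -> lD']; exists ([seq (c * p.1, p.2) | p <- l] ++ l').
  rewrite big_cat big_map scaler_sumr; congr (_ + _).
  by apply: eq_bigr => p _; rewrite scalerA.
by move=> p; rewrite mem_cat => /orP[/mapP[q /lD ? ->]|/lD'].
Qed.

Lemma hspanM D D' D'' f g : (forall s t, D s -> D' t -> D'' (s ++ t)) ->
  hspan D f -> hspan D' g -> hspan D'' (f * g).
Proof.
move=> DM [l -> lD] [l' -> lD'].
exists [seq (p.1 * q.1, p.2 ++ q.2) | p <- l, q <- l'].
  rewrite big_allpairs_dep mulr_suml; apply: eq_bigr => p _; rewrite mulr_sumr.
  by apply: eq_bigr => q _; rewrite -scalerAl -scalerAr scalerA hprod_cat.
move=> _ /allpairsP[[p q] [/lD[p0 Dp] /lD'[q0 Dq] ->]] /=.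
by rewrite mem_cat negb_or p0 q0; split=> //; apply: DM.
Qed.

(** The products of the h_k span because [hsupp_mono] expresses each monomial function through
    them. *)
Lemma hspanT f : hspan (fun=> True) f.
Proof.
elim/sf_mono_ind: f => [|c f g|lam]; [exact: hspan0 | exact: hspanP |].
have [l [lamE lP _]] := hsupp_mono F_char0 (intpart_mem0 lam).
exists [seq ((-1) ^+ size lam * (p.1 * (-1) ^+ size p.2), p.2) | p <- l].
  rewrite mkpart_id in lamE; rewrite big_map -[LHS](signrZK (size lam)) lamE scaler_sumr.
  by apply: eq_bigr => p _; rewrite signed_hprodE !scalerA mulrA.
by move=> _ /mapP[p /lP[_ p0 _] ->].
Qed.

Lemma sf_hprod_ind (P : symfun F -> Prop) : P 0 ->
  (forall c f g, P f -> P g -> P (c *: f + g)) ->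
  (forall s, 0%N \notin s -> P (hprod F s)) -> forall f, P f.
Proof.
move=> P0 PD Ph f; have [l -> lP] := hspanT f.
rewrite big_seq; elim/big_ind: _ => // [g h Pg Pk|p /lP[p0 _]].
  by rewrite -[g]scale1r; apply: PD.
by rewrite -[_ *: _]addr0; apply: PD => //; apply: Ph.
Qed.

(** An expansion of [g] in products of the h_k is chosen arbitrarily. By [sfcoef_hprodC] the value
    at [hprod F s] is the coefficient [sfcoef s g], which no longer depends on the choice; linearity
    in [g] follows since these products span. *)
Lemma hall_exists : exists B, is_hall (R := F) B.
Proof.
have /choice[rep repP] : forall f : symfun F, exists l : seq (F * seq nat),
    f = \sum_(p <- l) p.1 *: hprod F p.2.
  by move=> f; have [l fl _] := hspanT f; exists l.
pose B f g : F := \sum_(p <- rep g) p.1 * sfcoef p.2 f.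
have Bh s g : B (hprod F s) g = sfcoef s g.
  rewrite [in RHS](repP g) linear_sum; apply: eq_bigr => p _.
  by rewrite linearZ /= sfcoef_hprodC.
have B0 g : B 0 g = 0.
  by rewrite /B big1 // => p _; rewrite linear0 mulr0.
have Bl c f f' g : B (c *: f + f') g = c * B f g + B f' g.
  rewrite /B mulr_sumr -big_split; apply: eq_bigr => p _ /=.
  by rewrite linearP /= mulrDr mulrCA.
have Br c f g g' : B f (c *: g + g') = c * B f g + B f g'.
  elim/sf_hprod_ind: f => [|a f f' IH IH'|s _].
  - by rewrite !B0 mulr0 addr0.
  - by rewrite !Bl IH IH' !mulrDr !mulrA [a * c]mulrC addrACA.
  - by rewrite !Bh linearP.
exists B; split; first by split=> [g c f f'|f c g g']; [apply: Bl | apply: Br].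
move=> lam mu; rewrite [homsym_part _ _]/(hprod F lam) Bh sfcoef_monosym.
rewrite nonzeros_id ?intpart_mem0 //; congr (nat_of_bool _)%:R.
by apply/idP/eqP => [/perm_intpart|->].
Qed.

Lemma hallP : is_hall (hall (R := F)).
Proof. by have := xgetPex (fun _ _ => 0) hall_exists. Qed.

Lemma hall_linl c f f' g : hall (c *: f + f') g = c * hall f g + hall f' g :> F.
Proof. by have [[+ _] _] := hallP; apply. Qed.

Lemma hall_linr c f g g' : hall f (c *: g + g') = c * hall f g + hall f g' :> F.
Proof. by have [[_ +] _] := hallP; apply. Qed.

Lemma hall0l g : hall (0 : symfun F) g = 0.
Proof. by have := hall_linl (-1) 0 0 g; rewrite scaleN1r addNr mulN1r addNr. Qed.

Lemma hall0r f : hall f (0 : symfun F) = 0.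
Proof. by have := hall_linr (-1) f 0 0; rewrite scaleN1r addNr mulN1r addNr. Qed.

Lemma hall_suml g (I : Type) (r : seq I) (c : I -> F) (f : I -> symfun F) :
  hall (\sum_(i <- r) c i *: f i) g = \sum_(i <- r) c i * hall (f i) g.
Proof.
elim: r => [|i r IH]; first by rewrite !big_nil hall0l.
by rewrite !big_cons hall_linl IH.
Qed.

Lemma hall_hprod s g : hall (hprod F s) g = sfcoef s g.
Proof.
elim/sf_mono_ind: g => [|c f g IH IH'|lam].
- by rewrite hall0r linear0.
- by rewrite hall_linr IH IH' linearP.
have [_ Hhm] := hallP.
rewrite -hprod_mkpart [hprod _ _]/(homsym_part F (mkpart s)) Hhm sfcoef_monosym.
by rewrite eq_sym mkpart_eq perm_sym.
Qed.

Lemma hallC f g : hall f g = hall g f :> F.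
Proof.
elim/sf_hprod_ind: f => [|c f f' IH IH'|s _]; first by rewrite hall0l hall0r.
  by rewrite hall_linl hall_linr IH IH'.
elim/sf_hprod_ind: g => [|c f f' IH IH'|t _]; first by rewrite hall0l hall0r.
  by rewrite hall_linl hall_linr IH IH'.
by rewrite !hall_hprod sfcoef_hprodC.
Qed.

Lemma hall_sumr f (I : Type) (r : seq I) (c : I -> F) (g : I -> symfun F) :
  hall f (\sum_(i <- r) c i *: g i) = \sum_(i <- r) c i * hall f (g i).
Proof. by rewrite hallC hall_suml; under eq_bigr do rewrite hallC. Qed.

Lemma hall_mono_hprod (lam : intpart) s : 0%N \notin s ->
  hall (monosym F lam) (hprod F s) = (perm_eq s lam)%:R.
Proof. by move=> s0; rewrite hallC hall_hprod sfcoef_monosym nonzeros_id. Qed.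

(** Up to a global sign the product has a sign-positive h-expansion supported on all unions of a
    partition of |mu| with a partition of |kap|, and pairing with m_lam reads off the coefficient of
    h_lam. *)
Lemma hall_mono_mul (lam mu kap : intpart) :
  hall (monosym F lam) (monosym F mu * monosym F kap) != 0 <->
  splits (partition_of (weight mu)) (partition_of (weight kap)) lam.
Proof.
have hmu := hsupp_mono F_char0 (intpart_mem0 mu).
have hkap := hsupp_mono F_char0 (intpart_mem0 kap).
have := hsuppM hmu hkap; rewrite !mkpart_id -scalerAl -scalerAr scalerA => h.
rewrite -(hsupp_functional F_char0 (fun c => hall_linr c (monosym F lam))
  (fun s s0 => hall_mono_hprod lam s0) (intpart_mem0 lam) _ h); last first.
  by move=> s t st [a [b [ab a0 b0 ha hb]]]; exists a, b; rewrite -(permPr st).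
have := hall_linr ((-1) ^+ size mu * (-1) ^+ size kap) (monosym F lam)
  (monosym F mu * monosym F kap) 0.
by rewrite hall0r !addr0 => ->; rewrite !mulf_eq0 !signr_eq0.
Qed.

Lemma hall_mono_mul_weight (lam mu kap : intpart) :
  weight lam != (weight mu + weight kap)%N ->
  hall (monosym F lam) (monosym F mu * monosym F kap) = 0.
Proof.
apply: contra_neqP => /eqP/hall_mono_mul[a [b [ab _ _ ha hb]]].
by rewrite /weight -(perm_sumn ab) sumn_cat ha hb.
Qed.

(** The functional to be represented kills m_kap unless |kap| = n, so a finite combination of the
    h_kap, dual to the m_kap, represents it. *)
Lemma skewfun_exists (lam mu : intpart) n : weight lam = (weight mu + n)%N ->
  exists v : symfun F, forall f, hall v f = hall (monosym F lam) (monosym F mu * f).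
Proof.
move=> lamE; pose phi f := hall (monosym F lam) (monosym F mu * f).
exists (\sum_(kap <- intparts n.+1) phi (monosym F kap) *: hprod F kap).
elim/sf_mono_ind => [|c f g IH IH'|kap]; first by rewrite mulr0 !hall0r.
  by rewrite mulrDr -scalerAr !hall_linr IH IH'.
rewrite hall_suml -/(phi _).
under eq_bigr do rewrite hall_hprod sfcoef_monosym nonzeros_id ?intpart_mem0 //.
have pe (nu : intpart) : perm_eq nu kap = (nu == kap).
  by apply/idP/eqP => [/perm_intpart|->].
under eq_bigr do rewrite pe.
have [kl | kl] := boolP (kap \in intparts n.+1).
  rewrite (bigD1_seq kap) ?undup_uniq //= eqxx mulr1 big1 ?addr0 // => nu /negbTE->.
  by rewrite mulr0.
rewrite big1_seq => [|nu /= nul]; last first.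
  by case: eqP => [e|]; rewrite ?mulr0 //; rewrite -e nul in kl.
rewrite /phi hall_mono_mul_weight // lamE eqn_add2l.
by apply: contra kl => /eqP e; apply: mem_intparts; rewrite -e.
Qed.

Lemma hall_skewfun (lam mu : intpart) n f : weight lam = (weight mu + n)%N ->
  hall (skewfun (monosym F) lam mu) f = hall (monosym F lam) (monosym F mu * f).
Proof. by move=> /skewfun_exists ex; have := xgetPex 0 ex; apply. Qed.

(** Once some parts of [lam] sum to [n], the weight condition forces the others to sum to |mu|. *)
Lemma hall_skewfun_row (lam mu : intpart) n : weight lam = (weight mu + n)%N ->
  (0 < n)%N ->
  hall (mono [:: n]) (skewfun (monosym F) lam mu) != 0 <-> refines lam n.
Proof.
move=> lamE n0; rewrite hallC (hall_skewfun _ lamE) hall_mono_mul weight_mkpart /= addn0.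
rewrite refinesP; split=> [[a [b [ab _ _ _ bn]]]|[a [b [ab bn]]]]; exists a, b => //.
have : 0%N \notin a ++ b by rewrite (perm_mem ab) intpart_mem0.
rewrite mem_cat negb_or => /andP[a0 b0]; split=> //.
apply/eqP; rewrite -(eqn_add2r n) -lamE -{1}bn -sumn_cat.
by rewrite /weight (perm_sumn ab).
Qed.

Lemma hall_mono_skewfun_weight (lam mu kap : intpart) n :
  weight lam = (weight mu + n)%N -> weight kap != n ->
  hall (monosym F kap) (skewfun (monosym F) lam mu) = 0.
Proof.
move=> lamE kn; rewrite hallC (hall_skewfun _ lamE) hall_mono_mul_weight //.
by rewrite lamE eqn_add2l eq_sym.
Qed.

End Hall.

(** * The leading coefficient criterion *)


Section Criterion.
Variable F : fieldType.
Hypothesis F_char0 : [pchar F] =i pred0.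
Local Notation mono s := (monosym F (mkpart s)).

Lemma hall_mono_inj (f g : symfun F) :
  (forall kap, hall (monosym F kap) f = hall (monosym F kap) g) -> f = g.
Proof.
move=> fg; apply: sfcoef_inj => s _; rewrite -!(hall_hprod F_char0).
elim/sf_mono_ind: (hprod F s) => [|c h h' IH IH'|//]; first by rewrite !hall0l.
by rewrite !hall_linl // IH IH'.
Qed.

Lemma hall_mono_expansion (f : symfun F) : exists r : seq intpart,
  f = \sum_(kap <- r) hall (monosym F kap) f *: hprod F kap.
Proof.
have [l fE lP] := hspanT F_char0 f.
exists (undup [seq mkpart p.2 | p <- l]); apply: hall_mono_inj => nu.
rewrite hall_sumr //.
under eq_bigr => kap _.
  rewrite hall_mono_hprod ?intpart_mem0 //.
  rewrite (_ : perm_eq kap nu = (kap == nu)); first over.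
  by apply/idP/eqP => [/perm_intpart|->].
have [nur | nur] := boolP (nu \in undup [seq mkpart p.2 | p <- l]).
  rewrite (bigD1_seq nu) ?undup_uniq //= eqxx mulr1 big1 ?addr0 // => kap /negbTE->.
  by rewrite mulr0.
rewrite [RHS]big1_seq => [|kap /= kapr]; last first.
  by case: eqP => [e|]; rewrite ?mulr0 //; rewrite -e kapr in nur.
rewrite fE hall_sumr // big1_seq // => p /= pl; have [p0 _] := lP _ pl.
rewrite hall_mono_hprod //; case: (boolP (perm_eq _ _)) => [pnu|]; last by rewrite mulr0.
case/negP: nur; rewrite mem_undup; apply/mapP; exists p => //.
by apply/eqP; rewrite mkpart_eq nonzeros_id // perm_sym.
Qed.

Variable u : nat -> symfun F.
Hypothesis u_homog : forall (kap : intpart) n, (0 < n)%N -> weight kap != n ->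
  hall (monosym F kap) (u n) = 0.
(** The coefficient of h_n in [u n]. *)
Let c n : F := hall (mono [:: n]) (u n).
Let U : set (symfun F) := [set u n | n in [set n | (0 < n)%N]]%classic.

(** Homogeneity leaves only partitions of [n] in the h-expansion, and the subtraction removes the
    one with a single part. *)
Lemma u_lead n : (0 < n)%N ->
  hspan (fun s => sumn s = n /\ (1 < size s)%N) (u n - c n *: homsym F n).
Proof.
move=> n0; set w := _ - _; have [r ->] := hall_mono_expansion w.
elim/big_rec: _ => [|kap g _]; first exact: hspan0.
have [-> | nz] := eqVneq (hall (monosym F kap) w) 0; first by rewrite scale0r add0r.
apply: hspanP; apply: hspan_hprod; first exact: intpart_mem0.
have wE : hall (monosym F kap) w
    = hall (monosym F kap) (u n) - c n * (perm_eq [:: n] kap)%:R.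
  rewrite /w addrC -scaleNr hall_linr // -hprod1 hall_mono_hprod ?inE ?mulNr 1?addrC //.
  by rewrite eq_sym -lt0n.
have kn : sumn kap = n.
  apply/eqP; apply: contraNT nz => kn; rewrite wE u_homog // sub0r.
  case: (boolP (perm_eq _ _)) => [/perm_sumn e|]; last by rewrite mulr0 oppr0.
  by rewrite -e /= addn0 eqxx in kn.
split=> //; rewrite ltnNge; apply: contra nz.
case: kap kn wE => [[|k [|//]] kP]; first by move=> e; rewrite -e in n0.
rewrite /= addn0 => kn wE _; rewrite wE {wE}; subst k.
have -> : IntPart kP = mkpart [:: n].
  by apply/eqP; rewrite mkpart_eq nonzeros_id ?perm_refl // inE eq_sym -lt0n.
by rewrite perm_refl mulr1 subrr.
Qed.

(* Filtering by the number of parts makes the products of the [u n] triangular  *)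
(* with respect to the products of the [h_n], with diagonal entries            *)
(* [\prod c n].                                                               *)
Lemma prod_u_lead (t : seq nat) : 0%N \notin t ->
  hspan (fun s => (size t < size s)%N)
    (\prod_(n <- t) u n - (\prod_(n <- t) c n) *: hprod F t).
Proof.
elim: t => [_|n t IH].
  by rewrite /hprod !big_nil scale1r subrr; apply: hspan0.
rewrite inE negb_or eq_sym -lt0n => /andP[n0 t0].
set D := fun s => _.
have un : hspan (fun s => (0 < size s)%N) (u n).
  rewrite -(subrK (c n *: homsym F n) (u n)) addrC; apply: hspanP.
    by rewrite -hprod1; apply: hspan_hprod; rewrite // inE eq_sym -lt0n.
  have [l -> lP] := u_lead n0; exists l => // p /lP[p0 [_ /ltnW]].
  by [].
(* The difference is u_n (prod u - prod c h_t) + prod c (u_n - c_n h_n) h_t; each summand gains a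
   part. *)
have h1 : hspan D (u n * (\prod_(k <- t) u k - (\prod_(k <- t) c k) *: hprod F t)).
  apply: hspanM un (IH t0) => s s' s1 s2; rewrite /D /= size_cat.
  exact: leq_add s1 s2.
have h2 : hspan D ((u n - c n *: homsym F n) * hprod F t).
  have ht : hspan (fun s => size s = size t) (hprod F t) by apply: hspan_hprod.
  apply: hspanM (u_lead n0) ht => s s' [_ s1] s2.
  by rewrite /D /= size_cat s2 -[X in (X < _)%N]add1n ltn_add2r.
have := hspanP (\prod_(k <- t) c k) h2 h1; congr hspan.
rewrite !big_cons [hprod F (n :: t)]big_cons -/(hprod F t) mulrBl mulrBr scalerBr.
by rewrite -scalerAl scalerA -scalerAr addrC addrA subrK [c n * _]mulrC.
Qed.

Lemma hall_prod_u (t : seq nat) (kap : intpart) : 0%N \notin t ->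
  (size kap <= size t)%N ->
  hall (monosym F kap) (\prod_(n <- t) u n) = \prod_(n <- t) c n * (perm_eq t kap)%:R.
Proof.
move=> t0 kt; have [l lE lP] := prod_u_lead t0.
rewrite -(subrK ((\prod_(n <- t) c n) *: hprod F t) (\prod_(n <- t) u n)) addrC.
rewrite hall_linr // hall_mono_hprod // lE [X in _ + X](_ : _ = 0) ?addr0 //.
rewrite hall_sumr // big1_seq // => p /= /lP[p0 tp].
rewrite hall_mono_hprod //; case: (boolP (perm_eq _ _)) => [/perm_size e|].
  by move: (leq_ltn_trans kt tp); rewrite e ltnn.
by rewrite mulr0.
Qed.

(** This is the primitivity of p_n: a product h_s h_t equals h_n only if one of [s], [t] is empty
    and the other is [[:: n]]. *)
Lemma hall_row_mul n f g : (0 < n)%N ->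
  hall (mono [:: n]) (f * g) = hall (mono [:: n]) f * hall (mono [::]) g
                             + hall (mono [::]) f * hall (mono [:: n]) g.
Proof.
move=> n0.
elim/(sf_hprod_ind F_char0): f => [|a f f' IH IH'|s s0].
- by rewrite mul0r !hall0r // !mul0r addr0.
- by rewrite mulrDl -scalerAl !hall_linr // IH IH' !mulrDl mulrDr !mulrA addrACA.
elim/(sf_hprod_ind F_char0): g => [|a f f' IH IH'|t t0].
- by rewrite mulr0 !hall0r // !mulr0 addr0.
- by rewrite mulrDr -scalerAr !hall_linr // IH IH' !mulrDr ![_ * (a * _)]mulrCA addrACA.
have n0' : 0%N \notin [:: n] by rewrite inE eq_sym -lt0n.
have mn v : perm_eq v (mkpart [:: n]) = perm_eq v [:: n].
  by rewrite (permPr (perm_mkpart _)) nonzeros_id.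
rewrite -hprod_cat !hall_mono_hprod ?mem_cat ?negb_or ?s0 ?t0 //.
rewrite !mn !(permPr (perm_mkpart [::])) /=.
have nil1 : perm_eq [::] [:: n] = false by apply/negP => /perm_size.
case: s {s0} => [|a s]; first by rewrite cat0s nil1 mul0r add0r perm_refl mul1r.
have nilf b v : perm_eq (b :: v : seq nat) [::] = false by apply/negP => /perm_size.
rewrite nilf mul0r addr0; case: t {t0} => [|b t]; first by rewrite cats0 perm_refl mulr1.
rewrite nilf mulr0; case: (boolP (perm_eq _ _)) => // /perm_size.
by rewrite /= size_cat addnS.
Qed.

Lemma generates_lead : alg_generates U -> forall n, (0 < n)%N -> c n != 0.
Proof.
move=> genU n n0; apply/eqP => cn0.
have n0' : 0%N \notin [:: n] by rewrite inE eq_sym -lt0n.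
pose Q : {pred symfun F} := [pred f | hall (mono [:: n]) f == 0].
have QU f : U f -> f \in Q.
  case=> k k0 <-; rewrite inE; have [->|kn] := eqVneq k n; first exact/eqP.
  by rewrite u_homog // weight_mkpart /= addn0 eq_sym.
have Qalg : GRing.subalg_closed Q.
  split=> [|a f g|f g]; rewrite !inE.
  - have -> : 1 = hprod F [::] by rewrite /hprod big_nil.
    rewrite hall_mono_hprod //; case: (boolP (perm_eq _ _)) => [/perm_sumn e|] //.
    by move: e; rewrite -[RHS]/(weight _) weight_mkpart /= addn0 => e; rewrite -e in n0.
  - by move=> /eqP fn /eqP gn; rewrite hall_linr // fn gn mulr0 addr0.
  - by move=> /eqP fn /eqP gn; rewrite hall_row_mul // fn gn mulr0 mul0r addr0.
have := genU Q Qalg QU (hprod F [:: n]).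
rewrite inE hall_mono_hprod // (permPr (perm_mkpart [:: n])) nonzeros_id //.
by rewrite perm_refl oner_eq0.
Qed.

Lemma lead_generates : (forall n, (0 < n)%N -> c n != 0) -> alg_generates U.
Proof.
move=> c_neq0 Q Qalg QU; have [Q1 Qlin QM] := Qalg.
have Q0 : 0 \in Q by have := Qlin (-1) _ _ Q1 Q1; rewrite scaleN1r addNr.
have Qspan D f : (forall s, 0%N \notin s -> D s -> hprod F s \in Q) ->
    hspan D f -> f \in Q.
  move=> DQ [l -> lD]; rewrite big_seq; elim/big_rec: _ => // p g /lD[p0 Dp] Qg.
  by apply: Qlin => //; apply: DQ.
have Qprod s : (forall k, k \in s -> homsym F k \in Q) -> hprod F s \in Q.
  elim: s => [_|k s IH sQ]; first by rewrite /hprod big_nil.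
  rewrite /hprod big_cons QM ?sQ ?mem_head //.
  by apply: IH => j js; apply: sQ; rewrite inE js orbT.
have Qh n : homsym F n \in Q.
  elim/ltn_ind: n => n IH; have [->|n0] := posnP n; first by rewrite homsym0.
  have Qw : u n - c n *: homsym F n \in Q.
    apply: Qspan (u_lead n0) => s s0 [sn s1]; apply: Qprod => k ks; apply: IH.
    (* As [s] has at least two positive parts, removing [k] leaves a positive sum, so k < n. *)
    have := perm_sumn (perm_to_rem ks); rewrite sn /= => ->.
    rewrite -[X in (X < _)%N]addn0 ltn_add2l lt0n; apply/eqP => e.
    have /(sumn_eq0_nil)/(_ e) : 0%N \notin rem k s by apply: contra s0; apply: mem_rem.
    by move/(congr1 size); rewrite size_rem //; case: (size s) s1 => [|[]].
  have Un : u n \in Q by apply: QU; exists n.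
  have := Qlin (- (c n)^-1) _ _ Qw (Qlin (c n)^-1 _ _ Un Q0).
  by rewrite addr0 scaleNr scalerBr opprB subrK scalerA mulVf ?scale1r // c_neq0.
by move=> f; apply: Qspan (hspanT F_char0 f) => s _ _; apply: Qprod.
Qed.

(** A monomial of least degree in a relation [p] gives a product of u's with the fewest factors.
    Pairing with the monomial function of its type kills every other term by [hall_prod_u] and
    leaves its coefficient times a product of nonzero c's. *)
Lemma lead_independent : (forall n, (0 < n)%N -> c n != 0) -> alg_independent U.
Proof.
move=> c_neq0 n x x_inj xU p px.
have /choice[d dP] : forall i, exists k, (0 < k)%N /\ u k = x i.
  by move=> i; have [k k0 <-] := xU i; exists k.
have d_inj : injective d.
  by move=> i j ij; apply: x_inj; have [_ <-] := dP i; have [_ <-] := dP j; rewrite ij.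
(* [T m] is the multiset of indices of the u's that occur in the monomial [m]; as [d] is injective,
   it determines [m]. *)
pose T (m : 'X_{1..n}) := flatten [seq nseq (m i) (d i) | i <- enum 'I_n].
have T0 m : 0%N \notin T m.
  apply/flatten_mapP => -[i _]; rewrite mem_nseq => /andP[_ /eqP di].
  by have [] := dP i; rewrite -di.
have sizeT m : size (T m) = mdeg m.
  rewrite size_flatten /shape -map_comp sumnE big_map big_enum mdegE.
  by apply: eq_bigr => i _; rewrite /= size_nseq.
have countT m i : count_mem (d i) (T m) = m i.
  rewrite count_flatten -map_comp sumnE big_map big_enum (bigD1 i) //= big1 => [|j ji].
    by rewrite count_nseq /= eqxx mul1n addn0.
  by rewrite count_nseq /= (inj_eq d_inj) (negbTE ji).
have prodT m : \prod_(k <- T m) u k = mmap1 x m.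
  rewrite /T big_flatten big_map big_enum; apply: eq_bigr => i _.
  by rewrite big_nseq; have [_ ->] := dP i; rewrite -Monoid.iteropE.
apply/eqP/negPn/negP => p_neq0.
have ex_m : exists k, has (fun m => mdeg m == k) (msupp p).
  exists (mdeg (mlead p)); apply/hasP; exists (mlead p) => //.
  exact: mlead_supp.
have [k /hasP[m0 m0p /eqP <-] k_min] := ex_minnP ex_m.
have {}k_min m : m \in msupp p -> (mdeg m0 <= mdeg m)%N.
  by move=> mp; apply: k_min; apply/hasP; exists m.
have sT m : size (mkpart (T m)) = size (T m).
  by rewrite (perm_size (perm_mkpart _)) nonzeros_id.
have := congr1 (hall (mono (T m0))) px; rewrite hall0r // /mmap.
under eq_bigr do rewrite mulr_algl -prodT.
rewrite hall_sumr // (bigD1_seq m0) ?msupp_uniq //=.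
rewrite [X in _ + X]big1_seq => [|m /andP[mm0 mp]].
  rewrite hall_prod_u ?sT // (permPr (perm_mkpart _)) nonzeros_id //.
  rewrite perm_refl mulr1 addr0.
  move/eqP; rewrite mulf_eq0 mcoeff_eq0 m0p /= => /eqP/eqP.
  rewrite prodf_seq_eq0 => /hasP[j jT /=]; apply/negP; apply: c_neq0.
  by rewrite lt0n; apply: contraNneq (T0 m0) => <-.
rewrite hall_prod_u ?sT ?sizeT ?k_min // (permPr (perm_mkpart _)) nonzeros_id //.
case: (boolP (perm_eq _ _)) => [/seq.permP e|]; last by rewrite !mulr0.
by case/eqP: mm0; apply/mnmP => i; rewrite -!countT e.
Qed.

End Criterion.

Theorem theorem3p3 (F : fieldType) (F_char0 : [pchar F]%R =i pred0)
    (lam mu : nat -> intpart) (skew_seq : graded_skew_seq lam mu) :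
  let u (n : nat) : symfun F := skewfun (monosym F) (lam n) (mu n) in
  let U : set (symfun F) := [set u n | n in [set n | (0 < n)%N]]%classic in
  alg_independent U /\ alg_generates U <->
  forall n : nat, (0 < n)%N -> refines (lam n) n.
Proof.
move=> u U.
have u_homog (kap : intpart) n : (0 < n)%N -> weight kap != n ->
    hall (monosym F kap) (u n) = 0.
  by move=> _; apply: hall_mono_skewfun_weight.
have lead n : (0 < n)%N ->
    hall (monosym F (mkpart [:: n])) (u n) != 0 <-> refines (lam n) n.
  exact: hall_skewfun_row.
split=> [[_ genU] n n0 | ref]; first by apply/lead => //; apply: generates_lead genU n n0.
have c_neq0 n : (0 < n)%N -> hall (monosym F (mkpart [:: n])) (u n) != 0.
  by move=> n0; apply/lead/ref.
by split; [apply: lead_independent | apply: lead_generates].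
Qed.
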